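(* Let $K$ be a field, let $\Lambda=K\mathcal Q/I$ be the Brauer configuration algebra associated to a Brauer configuration $\Gamma$, and let $\mathcal C=\{C_1,\dots,C_t\}$ be a full set of representatives of the equivalence classes of special cycles. Assume that, for $i=1,\dots,t$, $C_i$ is a special $\alpha_i$-cycle, where $\alpha_i$ is a nontruncated vertex of $\Gamma$. Then $$\dim_K\Lambda=2|\mathcal Q_0|+\sum_{C_i\in\mathcal C}|C_i|\,(n_i|C_i|-1),$$ where $|\mathcal Q_0|$ is the number of vertices of $\mathcal Q$, $|C_i|$ is the number of arrows in $C_i$, and $n_i=\mu(\alpha_i)$.
   Context: Two special cycles are equivalent if one is a cyclic permutation of the other. Brauer configuration. A Brauer configuration $\Gamma=(\Gamma_0,\Gamma_1,\mu,\mathfrak o)$ consists of a finite set $\Gamma_0$ of vertices, a finite collection $\Gamma_1$ of labelled finite multisets of elements of $\Gamma_0$, called polygons (differently labelled polygons may be equal as multisets; a $d$-gon is a polygon with $d$ elements counted with multiplicity), a multiplicity function $\mu\colon\Gamma_0\to\mathbb Z_{>0}$, and an orientation $\mathfrak o$. For $\alpha\in\Gamma_0$, $V\in\Gamma_1$, $\mathrm{occ}(\alpha,V)$ is the number of times $\alpha$ occurs in $V$, and $\mathrm{val}(\alpha)=\sum_{V\in\Gamma_1}\mathrm{occ}(\alpha,V)$. An orientation is a choice, for each $\alpha\in\Gamma_0$, of a cyclic ordering of the list of polygons containing $\alpha$, where each $V$ is listed $\mathrm{occ}(\alpha,V)$ times (the different occurrences being distinguished). It is required that: every vertex lies in at least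 one polygon; every polygon has at least two vertices (counted with multiplicity); every polygon contains a vertex $\alpha$ with $\mathrm{val}(\alpha)\mu(\alpha)>1$. A vertex $\alpha$ is truncated if $\mathrm{val}(\alpha)\mu(\alpha)=1$, and nontruncated otherwise. Quiver. $\mathcal Q=\mathcal Q_\Gamma$ has one vertex $v$ for each polygon $V\in\Gamma_1$. For a nontruncated $\alpha$, the cyclically ordered list $V_1<\dots<V_t$ ($t=\mathrm{val}(\alpha)$, $V_{t+1}=V_1$) given by $\mathfrak o$ is the successor sequence at $\alpha$; for each $r=1,\dots,t$ there is an arrow $a_r$ from the vertex $v_r$ associated to $V_r$ to the vertex $v_{r+1}$ associated to $V_{r+1}$ (a loop if $t=1$). The arrows obtained for different $\alpha$ and different $r$ are distinct, and these are all arrows of $\mathcal Q$. Paths are written from left to right. Special cycles. With this notation put $C_j=a_ja_{j+1}\cdots a_ta_1\cdots a_{j-1}$. If $V$ is a polygon containing $\alpha$, the special $\alpha$-cycles at $v$ are the $C_j$ with $V_j=V$ (so there are $\mathrm{occ}(\alpha,V)$ of them). Algebra. $\Lambda=K\mathcal Q/I$, where $I$ is generated by: (type one) all $C^{\mu(\alpha)}-(C')^{\mu(\beta)}$ where, for some polygon $V$, $C$ is a special $\alpha$-cycle at $v$ and $C'$ is a special $\beta$-cycle at $v$, with $\alpha,\beta$ nontruncated vertices of $V$ (possibly $\alpha=\beta$); (type two) all $C^{\mu(\alpha)}a$ where $C$ is a special $\alpha$-cycle and $a$ is the first arrow of $C$; (type three) all paths $ab$ of length two that are not a subpath of any special cycle,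 except those with $a=b$ a loop associated to a vertex $\alpha$ with $\mathrm{val}(\alpha)=1$ and $\mu(\alpha)>1$. *)

(* Defs.v *)
From HB Require Import structures.
From mathcomp Require Import all_boot all_order all_fingroup all_algebra.
From mathcomp Require Import generic_quotient finmap multiset.
From mathcomp Require Import boolp.
From mathcomp.multinomials Require Import monalg.

Set Implicit Arguments.
Unset Strict Implicit.
Unset Printing Implicit Defensive.

Import GRing.Theory.
Local Open Scope fset_scope.
Local Open Scope mset_scope.
Local Open Scope ring_scope.
Local Open Scope quotient_scope.

(** * Quivers and paths *)

Record quiver := Quiver {
  qvertex : finType;
  qarrow : finType;
  qsrc : qarrow -> qvertex;
  qtgt : qarrow -> qvertex }.

Section Paths.
Variable Q : quiver.

(* [walk v s]: the arrows of [s], read from left to right, compose to a path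
   with source [v]. *)
Fixpoint walk (v : qvertex Q) (s : seq (qarrow Q)) : bool :=
  if s is a :: s' then (qsrc a == v) && walk (qtgt a) s' else true.

Record qpath := QPath {
  qpath_val : qvertex Q * seq (qarrow Q);
  _ : walk qpath_val.1 qpath_val.2 }.

HB.instance Definition _ := [isSub for qpath_val].
HB.instance Definition _ := [Choice of qpath by <:].

Definition psource (p : qpath) : qvertex Q := (val p).1.
Definition parrows (p : qpath) : seq (qarrow Q) := (val p).2.
Definition ptarget (p : qpath) : qvertex Q :=
  last (psource p) (map (@qtgt Q) (parrows p)).
Definition plength (p : qpath) : nat := size (parrows p).

Definition ptriv (v : qvertex Q) : qpath := @QPath (v, [::]) isT.

Fact parrow_subproof a : walk (qsrc a) [:: a].
Proof. by rewrite /= eqxx. Qed.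

Definition parrow (a : qarrow Q) : qpath :=
  @QPath (qsrc a, [:: a]) (parrow_subproof a).

(* Only meaningful when [ptarget p = psource q]; the default value [p] of
   [insubd] is then not used, see [val_pcat]. *)
Definition pcat (p q : qpath) : qpath :=
  insubd p (psource p, parrows p ++ parrows q).

Lemma walk_cat v s1 s2 :
  walk v (s1 ++ s2) = walk v s1 && walk (last v (map (@qtgt Q) s1)) s2.
Proof. by elim: s1 v => [|a s1 IH] v //=; rewrite IH andbA. Qed.

Lemma val_pcat p q : ptarget p = psource q ->
  val (pcat p q) = (psource p, parrows p ++ parrows q).
Proof.
move=> epq; apply: insubdK; rewrite -topredE /= walk_cat.
by move: epq; rewrite /ptarget => ->; rewrite (valP p) (valP q).
Qed.

Lemma psource_cat p q : ptarget p = psource q -> psource (pcat p q) = psource p.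
Proof. by move=> /val_pcat e; rewrite /psource e. Qed.

Lemma parrows_cat p q : ptarget p = psource q ->
  parrows (pcat p q) = parrows p ++ parrows q.
Proof. by move=> /val_pcat e; rewrite /parrows e. Qed.

Lemma ptarget_cat p q : ptarget p = psource q -> ptarget (pcat p q) = ptarget q.
Proof.
move=> e; rewrite /ptarget psource_cat // parrows_cat // map_cat last_cat.
by rewrite -/(ptarget p) e.
Qed.

Lemma pcatA p q r : ptarget p = psource q -> ptarget q = psource r ->
  pcat p (pcat q r) = pcat (pcat p q) r.
Proof.
move=> e1 e2; apply: val_inj.
rewrite !val_pcat ?psource_cat ?ptarget_cat //.
by rewrite !parrows_cat // catA.
Qed.

Lemma pcat_trivl p : pcat (ptriv (psource p)) p = p.
Proof. by apply: val_inj; rewrite val_pcat //; case: p => [[]]. Qed.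

Lemma pcat_trivr p : pcat p (ptriv (ptarget p)) = p.
Proof.
by apply: val_inj; rewrite val_pcat //= cats0; case: p => [[]].
Qed.

End Paths.

(** * The path algebra [KQ] *)

(* Finitely supported functions from the paths of [Q] to [K].  The operations
   are locked since unification otherwise unfolds them down to finite maps. *)
Record pathalg (K : fieldType) (Q : quiver) :=
  PathAlg { pathalg_val : {malg K[qpath Q]} }.

HB.instance Definition _ (K : fieldType) (Q : quiver) :=
  [isNew for @pathalg_val K Q].
HB.instance Definition _ (K : fieldType) (Q : quiver) :=
  [Choice of pathalg K Q by <:].

Fact pathalg_key : unit. Proof. by []. Qed.

Section PathAlgebra.
Variables (K : fieldType) (Q : quiver).
Local Notation KQ := (pathalg K Q).
Implicit Types (x y z : KQ) (p q r : qpath Q).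

Definition pcoef (p : qpath Q) (x : KQ) : K := (pathalg_val x)@_p.
Definition psupp (x : KQ) : {fset qpath Q} := msupp (pathalg_val x).

Definition pathalg_zero : KQ := locked_with pathalg_key (PathAlg 0).
Definition pathalg_opp : KQ -> KQ :=
  locked_with pathalg_key (fun x => PathAlg (- pathalg_val x)).
Definition pathalg_add : KQ -> KQ -> KQ :=
  locked_with pathalg_key
    (fun x y => PathAlg (pathalg_val x + pathalg_val y)).
Definition pathalg_scale : K -> KQ -> KQ :=
  locked_with pathalg_key (fun c x => PathAlg (c *: pathalg_val x)).

(* The basis element of [KQ] given by the path [p]. *)
Definition pathU : qpath Q -> KQ :=
  locked_with pathalg_key (fun p => PathAlg << 1 *g p >>).

Lemma pathalgP x y : (forall p, pcoef p x = pcoef p y) -> x = y.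
Proof. by move=> e; apply: val_inj; apply/malgP. Qed.

Fact pcoef_zero p : pcoef p pathalg_zero = 0.
Proof. by rewrite /pathalg_zero unlock; apply: mcoeff0. Qed.

Fact pcoef_opp p x : pcoef p (pathalg_opp x) = - pcoef p x.
Proof. by rewrite /pathalg_opp unlock; apply: mcoeffN. Qed.

Fact pcoef_add p x y : pcoef p (pathalg_add x y) = pcoef p x + pcoef p y.
Proof. by rewrite /pathalg_add unlock; apply: mcoeffD. Qed.

Fact pcoef_scale p c x : pcoef p (pathalg_scale c x) = c * pcoef p x.
Proof. by rewrite /pathalg_scale unlock; apply: mcoeffZ. Qed.

Lemma pcoefU p q : pcoef q (pathU p) = (p == q)%:R.
Proof. by rewrite /pathU unlock; apply: mcoeffU. Qed.

Fact pathalg_addA : associative pathalg_add.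
Proof. by move=> x y z; apply: pathalgP => p; rewrite !pcoef_add addrA. Qed.

Fact pathalg_addC : commutative pathalg_add.
Proof. by move=> x y; apply: pathalgP => p; rewrite !pcoef_add addrC. Qed.

Fact pathalg_add0 : left_id pathalg_zero pathalg_add.
Proof.
by move=> x; apply: pathalgP => p; rewrite pcoef_add pcoef_zero add0r.
Qed.

Fact pathalg_addN : left_inverse pathalg_zero pathalg_opp pathalg_add.
Proof.
move=> x; apply: pathalgP => p.
by rewrite pcoef_add pcoef_opp pcoef_zero addNr.
Qed.

HB.instance Definition _ := GRing.isZmodule.Build KQ
  pathalg_addA pathalg_addC pathalg_add0 pathalg_addN.

Lemma pcoef0 p : pcoef p 0 = 0.
Proof. exact: pcoef_zero. Qed.

Lemma pcoefD p x y : pcoef p (x + y) = pcoef p x + pcoef p y.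
Proof. exact: pcoef_add. Qed.

Fact pathalg_scaleA a b x :
  pathalg_scale a (pathalg_scale b x) = pathalg_scale (a * b) x.
Proof. by apply: pathalgP => p; rewrite !pcoef_scale mulrA. Qed.

Fact pathalg_scale1 : left_id 1 pathalg_scale.
Proof. by move=> x; apply: pathalgP => p; rewrite pcoef_scale mul1r. Qed.

Fact pathalg_scaleDr : right_distributive pathalg_scale +%R.
Proof.
move=> c x y; apply: pathalgP => p.
by rewrite pcoef_scale !pcoefD !pcoef_scale mulrDr.
Qed.

Fact pathalg_scaleDl x : {morph pathalg_scale^~ x : a b / a + b}.
Proof.
move=> a b; apply: pathalgP => p.
by rewrite pcoef_scale !pcoefD !pcoef_scale mulrDl.
Qed.

HB.instance Definition _ := GRing.Zmodule_isLmodule.Build K KQ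
  pathalg_scaleA pathalg_scale1 pathalg_scaleDr pathalg_scaleDl.

Lemma pcoefZ p c x : pcoef p (c *: x) = c * pcoef p x.
Proof. exact: pcoef_scale. Qed.

Lemma pcoef_sum p I (s : seq I) (F : I -> KQ) :
  pcoef p (\sum_(i <- s) F i) = \sum_(i <- s) pcoef p (F i).
Proof. exact: (big_morph (pcoef p) (pcoefD p) (pcoef0 p)). Qed.

Lemma pcoef_outsupp p x : p \notin psupp x -> pcoef p x = 0.
Proof. exact: mcoeff_outdom. Qed.

Lemma psuppU p : psupp (pathU p) = [fset p]%fset.
Proof. by rewrite /psupp /pathU unlock /= msuppU oner_eq0. Qed.

Lemma psupp_sub x (d : {fset qpath Q}) :
  (forall p, p \notin d -> pcoef p x = 0) -> (psupp x `<=` d)%fset.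
Proof.
move=> h; apply/fsubsetP => p; apply: contraTT => /h e.
by rewrite /psupp -mcoeff_eq0; apply/eqP.
Qed.

Lemma pathalgE x : x = \sum_(p <- psupp x) pcoef p x *: pathU p.
Proof.
apply: pathalgP => q; rewrite pcoef_sum.
under eq_bigr do rewrite pcoefZ pcoefU.
have [qx|qx] := boolP (q \in psupp x).
  rewrite (big_fsetD1 q) //= eqxx mulr1 big1_fset ?addr0 // => p.
  by rewrite in_fsetD1 => /andP[/negPf-> _] _; rewrite mulr0.
rewrite pcoef_outsupp // big1_fset // => p px _.
by case: eqVneq px qx => [-> ->|] //; rewrite mulr0.
Qed.

(* [p * q] in [KQ]. *)
Definition pmul (p q : qpath Q) : KQ :=
  if ptarget p == psource q then pathU (pcat p q) else 0.

Definition pathalg_mul : KQ -> KQ -> KQ :=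
  locked_with pathalg_key (fun x y =>
    \sum_(p <- psupp x) \sum_(q <- psupp y)
      (pcoef p x * pcoef q y) *: pmul p q).

Definition pathalg_one : KQ := \sum_(v : qvertex Q) pathU (ptriv v).

Lemma pathalg_mulw (d1 d2 : {fset qpath Q}) x y :
  (psupp x `<=` d1)%fset -> (psupp y `<=` d2)%fset ->
  pathalg_mul x y =
  \sum_(p <- d1) \sum_(q <- d2) (pcoef p x * pcoef q y) *: pmul p q.
Proof.
move=> le1 le2; rewrite /pathalg_mul unlock (big_fset_incl _ le1) /=;
  last first.
  move=> p _ /pcoef_outsupp xp; rewrite big1 // => q _.
  by rewrite xp mul0r scale0r.
apply: eq_bigr => p _; apply: big_fset_incl => // q _ /pcoef_outsupp ->.
by rewrite mulr0 scale0r.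
Qed.

Lemma psuppD_le x y : (psupp (x + y)%R `<=` psupp x `|` psupp y)%fset.
Proof.
apply: psupp_sub => p; rewrite in_fsetU negb_or => /andP[px py].
by rewrite pcoefD !pcoef_outsupp ?addr0.
Qed.

Lemma psuppZ_le c x : (psupp (c *: x)%R `<=` psupp x)%fset.
Proof. by apply: psupp_sub => p px; rewrite pcoefZ pcoef_outsupp ?mulr0. Qed.

Lemma pathalg_mulDl : left_distributive pathalg_mul +%R.
Proof.
move=> x y z; rewrite (pathalg_mulw (psuppD_le x y) (fsubset_refl _)).
rewrite (pathalg_mulw (fsubsetUl (psupp x) (psupp y)) (fsubset_refl (psupp z))).
rewrite (pathalg_mulw (fsubsetUr (psupp x) (psupp y)) (fsubset_refl (psupp z))).
rewrite -big_split /=; apply: eq_bigr => p _.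
rewrite -big_split /=; apply: eq_bigr => q _.
by rewrite pcoefD mulrDl scalerDl.
Qed.

Lemma pathalg_mulDr : right_distributive pathalg_mul +%R.
Proof.
move=> z x y; rewrite (pathalg_mulw (fsubset_refl _) (psuppD_le x y)).
rewrite (pathalg_mulw (fsubset_refl (psupp z)) (fsubsetUl (psupp x) (psupp y))).
rewrite (pathalg_mulw (fsubset_refl (psupp z)) (fsubsetUr (psupp x) (psupp y))).
rewrite -big_split /=; apply: eq_bigr => p _.
rewrite -big_split /=; apply: eq_bigr => q _.
by rewrite pcoefD mulrDr scalerDl.
Qed.

Lemma pathalg_mulZl c x y : pathalg_mul (c *: x) y = c *: pathalg_mul x y.
Proof.
rewrite (pathalg_mulw (psuppZ_le c x) (fsubset_refl _)).
rewrite [in RHS](pathalg_mulw (fsubset_refl _) (fsubset_refl _)) scaler_sumr.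
apply: eq_bigr => p _; rewrite scaler_sumr; apply: eq_bigr => q _.
by rewrite pcoefZ scalerA mulrA.
Qed.

Lemma pathalg_mulZr c x y : pathalg_mul x (c *: y) = c *: pathalg_mul x y.
Proof.
rewrite (pathalg_mulw (fsubset_refl _) (psuppZ_le c y)).
rewrite [in RHS](pathalg_mulw (fsubset_refl _) (fsubset_refl _)) scaler_sumr.
apply: eq_bigr => p _; rewrite scaler_sumr; apply: eq_bigr => q _.
by rewrite pcoefZ scalerA mulrCA.
Qed.

Lemma pathalg_mul0l x : pathalg_mul 0 x = 0.
Proof. by rewrite -[in LHS](scale0r 0) pathalg_mulZl scale0r. Qed.

Lemma pathalg_mul0r x : pathalg_mul x 0 = 0.
Proof. by rewrite -[in LHS](scale0r 0) pathalg_mulZr scale0r. Qed.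

Lemma pathalg_mulLl y : linear (pathalg_mul^~ y).
Proof. by move=> c x x'; rewrite pathalg_mulDl pathalg_mulZl. Qed.

Lemma pathalg_mulLr x : linear (pathalg_mul x).
Proof. by move=> c y y'; rewrite pathalg_mulDr pathalg_mulZr. Qed.

Lemma pathalg_ext (f g : KQ -> KQ) : linear f -> linear g ->
  (forall p, f (pathU p) = g (pathU p)) -> f =1 g.
Proof.
move=> Lf Lg fg x; rewrite (pathalgE x).
have f0 : f 0 = 0 by have := Lf (-1) 0 0; rewrite scaler0 addr0 scaleN1r addNr.
have g0 : g 0 = 0 by have := Lg (-1) 0 0; rewrite scaler0 addr0 scaleN1r addNr.
elim: (enum_fset (psupp x)) => [|p s IH]; first by rewrite big_nil f0 g0.
by rewrite big_cons Lf Lg IH fg.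
Qed.

Lemma pathalg_mulUU p q : pathalg_mul (pathU p) (pathU q) = pmul p q.
Proof.
rewrite (pathalg_mulw (fsubset_refl _) (fsubset_refl _)) !psuppU.
rewrite !big_seq_fset1 !pcoefU !eqxx.
by rewrite mulr1 scale1r.
Qed.

Lemma pathalg_mulUA p q r :
  pathalg_mul (pathU p) (pathalg_mul (pathU q) (pathU r)) =
  pathalg_mul (pathalg_mul (pathU p) (pathU q)) (pathU r).
Proof.
rewrite !pathalg_mulUU /pmul; case: (eqVneq (ptarget p) (psource q)) => e1.
  case: (eqVneq (ptarget q) (psource r)) => e2.
    rewrite !pathalg_mulUU /pmul psource_cat // ptarget_cat //.
    by rewrite e1 e2 !eqxx pcatA.
  by rewrite pathalg_mul0r pathalg_mulUU /pmul ptarget_cat // (negPf e2).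
rewrite pathalg_mul0l; case: (eqVneq (ptarget q) (psource r)) => e2.
  by rewrite pathalg_mulUU /pmul psource_cat // (negPf e1).
by rewrite pathalg_mul0r.
Qed.

Lemma pathalg_mulA : associative pathalg_mul.
Proof.
move=> x y z; move: x; apply: pathalg_ext => [||p].
- exact: pathalg_mulLl.
- by move=> c x x'; rewrite !pathalg_mulLl.
move: y; apply: pathalg_ext => [||q].
- by move=> c y y'; rewrite pathalg_mulLl pathalg_mulLr.
- by move=> c y y'; rewrite pathalg_mulLr pathalg_mulLl.
move: z; apply: pathalg_ext => [||r].
- by move=> c z z'; rewrite !pathalg_mulLr.
- exact: pathalg_mulLr.
exact: pathalg_mulUA.
Qed.

Lemma pathalg_mul1l : left_id pathalg_one pathalg_mul.
Proof.
apply: pathalg_ext => [||p]; [exact: pathalg_mulLr | by [] |].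
rewrite /pathalg_one.
rewrite (big_morph (pathalg_mul^~ (pathU p))
  (fun a b => pathalg_mulDl a b _) (pathalg_mul0l _)).
rewrite (bigD1 (psource p)) //= pathalg_mulUU /pmul eqxx pcat_trivl.
rewrite big1 ?addr0 // => v /negPf ne.
by rewrite pathalg_mulUU /pmul ne.
Qed.

Lemma pathalg_mul1r : right_id pathalg_one pathalg_mul.
Proof.
apply: (@pathalg_ext (pathalg_mul^~ pathalg_one)) => [||p].
- exact: pathalg_mulLl.
- by [].
rewrite /pathalg_one.
rewrite (big_morph (pathalg_mul (pathU p)) (pathalg_mulDr _) (pathalg_mul0r _)).
rewrite (bigD1 (ptarget p)) //= pathalg_mulUU /pmul eqxx pcat_trivr.
rewrite big1 ?addr0 // => v ne.
by rewrite pathalg_mulUU /pmul eq_sym (negPf ne).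
Qed.

(* [KQ] is zero when [Q] has no vertex, hence only a [pzRingType]; the library's
   [lalgType] and [algType] require nontrivial rings. *)
HB.instance Definition _ := GRing.Zmodule_isPzRing.Build KQ
  pathalg_mulA pathalg_mul1l pathalg_mul1r pathalg_mulDl pathalg_mulDr.

Lemma pathalg_scalerAl c x y : c *: (x * y) = (c *: x) * y.
Proof. by rewrite /GRing.mul /= pathalg_mulZl. Qed.

Lemma pathalg_scalerAr c x y : c *: (x * y) = x * (c *: y).
Proof. by rewrite /GRing.mul /= pathalg_mulZr. Qed.

Lemma pathU_mul p q : pathU p * pathU q = pmul p q.
Proof. exact: pathalg_mulUU. Qed.

End PathAlgebra.

(** * Two-sided ideals and quotients of path algebras *)

(* The two-sided ideal generated by [S]: all finite sums of [u * r * v] with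
   [r] in [S]. *)
Inductive ideal_gen (R : pzRingType) (S : R -> Prop) : R -> Prop :=
| ideal_gen0 : ideal_gen S 0
| ideal_genD u r v x : S r -> ideal_gen S x -> ideal_gen S (u * r * v + x).

Section IdealGen.
Variables (R : pzRingType) (S : R -> Prop).

Lemma ideal_gen_add x y : ideal_gen S x -> ideal_gen S y -> ideal_gen S (x + y).
Proof.
elim=> [|u r v {}x Sr _ IH] Iy; rewrite ?add0r // -addrA.
by apply: ideal_genD => //; apply: IH.
Qed.

Lemma ideal_gen_opp x : ideal_gen S x -> ideal_gen S (- x).
Proof.
elim=> [|u r v {}x Sr _ IH]; first by rewrite oppr0; apply: ideal_gen0.
by rewrite opprD -!mulNr; apply: ideal_genD.
Qed.

Lemma ideal_gen_mull w x : ideal_gen S x -> ideal_gen S (w * x).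
Proof.
elim=> [|u r v {}x Sr _ IH]; first by rewrite mulr0; apply: ideal_gen0.
by rewrite mulrDr !mulrA; apply: ideal_genD.
Qed.

Lemma ideal_gen_mulr w x : ideal_gen S x -> ideal_gen S (x * w).
Proof.
elim=> [|u r v {}x Sr _ IH]; first by rewrite mul0r; apply: ideal_gen0.
by rewrite mulrDl -mulrA; apply: ideal_genD.
Qed.

Definition ideal_pred : pred R := fun x => `[< ideal_gen S x >].

Fact ideal_pred_zmod_closed : zmod_closed ideal_pred.
Proof.
split=> [|x y]; rewrite !unfold_in; first exact/asboolP/ideal_gen0.
move=> /asboolP Ix /asboolP Iy; apply/asboolP.
exact/ideal_gen_add/ideal_gen_opp.
Qed.

HB.instance Definition _ :=
  GRing.isZmodClosed.Build R ideal_pred ideal_pred_zmod_closed.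

End IdealGen.

(* [KQ / I] where [I] is the two-sided ideal generated by [S]. *)
Definition quotalg (K : fieldType) (Q : quiver)
    (S : pathalg K Q -> Prop) : Type :=
  {ideal_quot (GRing.ZmodClosed.clone (pathalg K Q) (ideal_pred S) _)}.

Section QuotientAlgebra.
Variables (K : fieldType) (Q : quiver) (S : pathalg K Q -> Prop).
Local Notation KQ := (pathalg K Q).
Local Notation A := (quotalg S).

HB.instance Definition _ := GRing.Zmodule.on A.
HB.instance Definition _ := EqQuotient.on A.

Lemma quotalg_eqP (x y : KQ) : \pi_A x = \pi_A y <-> ideal_gen S (x - y).
Proof.
have e := Quotient.idealrBE (GRing.ZmodClosed.clone KQ (ideal_pred S) _) x y.
rewrite (rwP eqP) -[X in is_true X <-> _]e unfold_in.
by split=> /asboolP.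
Qed.

Lemma quotalg_repr (x : KQ) : ideal_gen S (repr (\pi_A x) - x).
Proof. by apply/quotalg_eqP; rewrite reprK. Qed.

Lemma quotalg_piD (x y : KQ) : \pi_A (x + y) = \pi_A x + \pi_A y.
Proof. exact: Quotient.pi_add. Qed.

Definition quotalg_scale : K -> A -> A :=
  locked_with pathalg_key (fun c x => \pi_A (c *: repr x)).
Definition quotalg_one : A := \pi_A 1.
Definition quotalg_mul : A -> A -> A :=
  locked_with pathalg_key (fun x y => \pi_A (repr x * repr y)).

Lemma quotalg_piZ c (x : KQ) : quotalg_scale c (\pi_A x) = \pi_A (c *: x).
Proof.
rewrite /quotalg_scale unlock; apply/quotalg_eqP.
rewrite -scalerBr -[X in c *: X]mul1r pathalg_scalerAl.
exact/ideal_gen_mull/quotalg_repr.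
Qed.

Lemma quotalg_piM (x y : KQ) :
  quotalg_mul (\pi_A x) (\pi_A y) = \pi_A (x * y).
Proof.
rewrite /quotalg_mul unlock; apply/quotalg_eqP.
set x' := repr _; set y' := repr _.
have -> : x' * y' - x * y = (x' - x) * y' + x * (y' - y).
  by rewrite mulrBl mulrBr addrA subrK.
by apply: ideal_gen_add; [apply: ideal_gen_mulr | apply: ideal_gen_mull];
  apply: quotalg_repr.
Qed.

Fact quotalg_scaleA a b x :
  quotalg_scale a (quotalg_scale b x) = quotalg_scale (a * b) x.
Proof. by elim/quotW: x => x; rewrite !quotalg_piZ scalerA. Qed.

Fact quotalg_scale1 : left_id 1 quotalg_scale.
Proof. by elim/quotW => x; rewrite quotalg_piZ scale1r. Qed.

Fact quotalg_scaleDr : right_distributive quotalg_scale +%R.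
Proof.
move=> c x y; elim/quotW: x => x; elim/quotW: y => y.
by rewrite -quotalg_piD !quotalg_piZ scalerDr quotalg_piD.
Qed.

Fact quotalg_scaleDl x : {morph quotalg_scale^~ x : a b / a + b}.
Proof.
by elim/quotW: x => x a b; rewrite !quotalg_piZ scalerDl quotalg_piD.
Qed.

HB.instance Definition _ := GRing.Zmodule_isLmodule.Build K A
  quotalg_scaleA quotalg_scale1 quotalg_scaleDr quotalg_scaleDl.

Fact quotalg_mulA : associative quotalg_mul.
Proof.
move=> x y z; elim/quotW: x => x; elim/quotW: y => y; elim/quotW: z => z.
by rewrite !quotalg_piM mulrA.
Qed.

Fact quotalg_mul1l : left_id quotalg_one quotalg_mul.
Proof. by elim/quotW => x; rewrite quotalg_piM mul1r. Qed.

Fact quotalg_mul1r : right_id quotalg_one quotalg_mul.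
Proof. by elim/quotW => x; rewrite quotalg_piM mulr1. Qed.

Fact quotalg_mulDl : left_distributive quotalg_mul +%R.
Proof.
move=> x y z; elim/quotW: x => x; elim/quotW: y => y; elim/quotW: z => z.
by rewrite -quotalg_piD !quotalg_piM -quotalg_piD mulrDl.
Qed.

Fact quotalg_mulDr : right_distributive quotalg_mul +%R.
Proof.
move=> x y z; elim/quotW: x => x; elim/quotW: y => y; elim/quotW: z => z.
by rewrite -quotalg_piD !quotalg_piM -quotalg_piD mulrDr.
Qed.

HB.instance Definition _ := GRing.Zmodule_isPzRing.Build A
  quotalg_mulA quotalg_mul1l quotalg_mul1r quotalg_mulDl quotalg_mulDr.

End QuotientAlgebra.

(** * Brauer configurations *)

Section Occurrences.
Variables (T L : finType) (P : L -> {mset T}).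

Definition occ (a : T) (V : L) : nat := P V a.
Definition valency (a : T) : nat := (\sum_(V : L) occ a V)%N.

(* The list of polygons containing [a], each [V] listed [occ a V] times with
   its occurrences distinguished. *)
Definition occurrence (a : T) := {V : L & 'I_(occ a V)}.

End Occurrences.

(* [bc_orient a] is the successor map of the cyclic ordering at [a]: a
   permutation of the occurrences of [a] consisting of one cycle. *)
Record brauer_configuration := BrauerConfiguration {
  bc_vertex : finType;
  bc_label : finType;
  bc_polygon : bc_label -> {mset bc_vertex};
  bc_mult : bc_vertex -> nat;
  bc_orient : forall a : bc_vertex, {perm occurrence bc_polygon a};
  bc_mult_gt0 : forall a, (0 < bc_mult a)%N;
  bc_orient_cyclic :
    forall (a : bc_vertex) (x y : occurrence bc_polygon a),
      y \in porbit (bc_orient a) x;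
  bc_vertexP : forall a, exists V, a \in bc_polygon V;
  bc_polygonP : forall V, (2 <= size (bc_polygon V))%N;
  bc_nontruncP : forall V, exists2 a, a \in bc_polygon V &
    (1 < valency bc_polygon a * bc_mult a)%N }.

Section BrauerAlgebra.
Variable G : brauer_configuration.

Local Notation val_ := (valency (@bc_polygon G)).
Local Notation mu := (@bc_mult G).

Definition truncated (a : bc_vertex G) : bool := (val_ a * mu a == 1)%N.

Definition ntvertex := {a : bc_vertex G | ~~ truncated a}.

(* The arrow attached to the occurrence [x] of [V_r] in the successor sequence
   at [a] is [a_r : v_r -> v_(r+1)]. *)
Definition barrow := {a : ntvertex & occurrence (@bc_polygon G) (val a)}.

Definition succ_arrow (b : barrow) : barrow :=
  Tagged (fun a : ntvertex => occurrence (@bc_polygon G) (val a))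
    (bc_orient (val (tag b)) (tagged b)).

Definition bquiver : quiver :=
  @Quiver (bc_label G) barrow
    (fun b => tag (tagged b)) (fun b => tag (tagged (succ_arrow b))).

(* For [b = a_j], the cycle [C_j = a_j a_(j+1) ... a_t a_1 ... a_(j-1)]. *)
Definition scycle_arrows (b : barrow) : seq barrow :=
  traject succ_arrow b (val_ (val (tag b))).

Lemma walk_traject (b : barrow) n :
  @walk bquiver (qsrc (q := bquiver) b) (traject succ_arrow b n).
Proof.
by elim: n b => //= n IH b; rewrite eqxx; apply: (IH (succ_arrow b)).
Qed.

Definition scycle (b : barrow) : qpath bquiver :=
  @QPath bquiver (qsrc (q := bquiver) b, scycle_arrows b) (walk_traject b _).

(* [C] is a special [a]-cycle at [v], the vertex of the quiver given by [V]. *)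
Definition special_at (a : ntvertex) (V : bc_label G) (C : qpath bquiver) :
    Prop :=
  exists x : occurrence (@bc_polygon G) (val a),
    tag x = V /\ C = scycle (existT _ a x).

Definition special (a : ntvertex) (C : qpath bquiver) : Prop :=
  exists V, special_at a V C.

Definition special_cycle (C : qpath bquiver) : Prop := exists a, special a C.

Definition cyc_equiv (C D : qpath bquiver) : Prop :=
  exists k, parrows D = rot k (parrows C).

(* [C] lists exactly one representative of each equivalence class of special
   cycles. *)
Definition representatives (t : nat) (C : 'I_t -> qpath bquiver) : Prop :=
  (forall i, special_cycle (C i)) /\
  (forall D, special_cycle D -> exists! i, cyc_equiv D (C i)).

Variable K : fieldType.
Local Notation KQ := (pathalg K bquiver).

(* In [rel_three], [a = b] forces the arrow [a] to be a loop, the path being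
   composable. *)
Inductive brauer_rel : KQ -> Prop :=
| rel_one (V : bc_label G) (a b : ntvertex) (C D : qpath bquiver) :
    special_at a V C -> special_at b V D ->
    brauer_rel (pathU K C ^+ mu (val a) - pathU K D ^+ mu (val b))
| rel_two (a : ntvertex) (C : qpath bquiver) (b : barrow) :
    special a C -> ohead (parrows C) = Some b ->
    brauer_rel (pathU K C ^+ mu (val a) * pathU K (parrow (Q := bquiver) b))
| rel_three (p : qpath bquiver) (a b : barrow) :
    parrows p = [:: a; b] ->
    (forall C, special_cycle C -> ~~ infix [:: a; b] (parrows C)) ->
    ~~ [&& a == b, val_ (val (tag a)) == 1%N & (1 < mu (val (tag a)))%N] ->
    brauer_rel (pathU K p).

Definition brauer_algebra : Type := quotalg brauer_rel.

HB.instance Definition _ := GRing.Lmodule.on brauer_algebra.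
HB.instance Definition _ := GRing.PzRing.on brauer_algebra.

End BrauerAlgebra.

Arguments brauer_algebra G K : clear implicits.

Definition has_dimension (K : fieldType) (V : lmodType K) (n : nat) : Prop :=
  inhabited (Vector.axiom n V).

(* Main.v *)
(** A path of positive length starting with the arrow [b] survives in [Lambda]
    only if it runs along the special cycle through [b] (type three relations)
    and has length at most [mu * val] (type two relations); by the type one
    relations all such paths of maximal length at a given vertex coincide.  A
    basis is therefore given by the trivial paths, one maximal path at every
    vertex of the quiver, and the [mu * val - 1] shorter nontrivial paths
    starting with each arrow.  These elements are linearly independent because
    the linear map sending every path to its normal form (a basis element or 0)
    kills [u r v] for all paths [u], [v] and relations [r]: as soon as [u] or
    [v] is nontrivial, the product is too long or leaves its special cycle.
    Finally a class of special cycles amounts to a nontruncated vertex, so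
    summing over arrows is summing [|C_i|] over representatives. *)
Require Import Defs.
From mathcomp Require Import all_boot all_order all_fingroup all_algebra.
From HB Require Import structures.
From mathcomp Require Import generic_quotient finmap.

Set Implicit Arguments.
Unset Strict Implicit.
Unset Printing Implicit Defensive.

Import GRing.Theory.
Local Open Scope ring_scope.
Local Open Scope quotient_scope.

(** * Linear maps out of a path algebra *)

Section LinearExtension.
Variables (K : fieldType) (Q : quiver) (V : lmodType K) (h : qpath Q -> V).
Local Notation KQ := (pathalg K Q).
Implicit Types x y : KQ.

Lemma pathalg_lin_ind (P : KQ -> Prop) :
  P 0 -> (forall c p x, P x -> P (c *: pathU K p + x)) -> forall x, P x.
Proof.
move=> P0 PD x; rewrite (pathalgE x).
elim: (enum_fset (psupp x)) => [|p s IH]; first by rewrite big_nil.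
by rewrite big_cons; apply: PD.
Qed.

Definition pathlin x : V := \sum_(p <- psupp x) pcoef p x *: h p.

Lemma pathlinw (d : {fset qpath Q}) x : (psupp x `<=` d)%fset ->
  pathlin x = \sum_(p <- d) pcoef p x *: h p.
Proof.
by move=> le; apply: big_fset_incl => // p _ /pcoef_outsupp ->; rewrite scale0r.
Qed.

Fact pathlin_linear : linear pathlin.
Proof.
move=> c x y; pose d := (psupp x `|` psupp y)%fset.
have lex : (psupp x `<=` d)%fset by apply: fsubsetUl.
have ley : (psupp y `<=` d)%fset by apply: fsubsetUr.
have le : (psupp (c *: x + y)%R `<=` d)%fset.
  apply: psupp_sub => p; rewrite in_fsetU negb_or => /andP[px py].
  by rewrite pcoefD pcoefZ !pcoef_outsupp ?mulr0 ?addr0.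
rewrite (pathlinw le) (pathlinw lex) (pathlinw ley) scaler_sumr -big_split.
by apply: eq_bigr => p _; rewrite pcoefD pcoefZ scalerDl scalerA.
Qed.

HB.instance Definition _ :=
  GRing.isLinear.Build K KQ V *:%R pathlin pathlin_linear.

Lemma pathlinU p : pathlin (pathU K p) = h p.
Proof. by rewrite /pathlin psuppU big_seq_fset1 pcoefU eqxx scale1r. Qed.

(** Both outer factors of [u * r * v] expand linearly into paths, so vanishing on an ideal need only
    be tested with paths around a generator. *)
Lemma pathlin_ideal0 (S : KQ -> Prop) :
  (forall u r v, S r -> pathlin (pathU K u * r * pathU K v) = 0) ->
  forall x, ideal_gen S x -> pathlin x = 0.
Proof.
move=> Sh x; elim=> [|u r v {}x Sr _ IH]; first exact: raddf0.
rewrite linearD /= IH addr0.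
elim/pathalg_lin_ind: u => [|c p u IHu]; first by rewrite !mul0r raddf0.
rewrite !mulrDl linearD /= IHu addr0 -!pathalg_scalerAl linearZ /=.
apply/eqP; rewrite scaler_eq0; apply/orP; right; apply/eqP => {u IHu}.
elim/pathalg_lin_ind: v => [|{}c q v IHv]; first by rewrite !mulr0 raddf0.
by rewrite mulrDr linearD /= IHv addr0 -pathalg_scalerAr linearZ /= Sh ?scaler0.
Qed.

End LinearExtension.

(** * Dimension of a quotient from a normal form on paths *)

Section MonomialDimension.
Variables (K : fieldType) (Q : quiver) (S : pathalg K Q -> Prop) (B : finType).
Variable (f : qpath Q -> option B).
Local Notation KQ := (pathalg K Q).

Definition basis_row (o : option B) : 'rV[K]_#|B| :=
  if o is Some b then delta_mx 0 (enum_rank b) else 0.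

Lemma ideal_gen_scale c (x : KQ) : ideal_gen S x -> ideal_gen S (c *: x).
Proof.
by move=> Ix; rewrite -[x]mul1r pathalg_scalerAl; apply: ideal_gen_mull.
Qed.

(** The linear extension [F] of [f] factors through the quotient by the third hypothesis. The map
    [N] built from [g] is a right inverse of [F] by the first, and [N (F x)] is congruent to [x] by
    the second, so [F] and [N] induce inverse isomorphisms. *)
Lemma quotalg_dimension (g : B -> qpath Q) :
    (forall b, f (g b) = Some b) ->
    (forall p, ideal_gen S
       (pathU K p - if f p is Some b then pathU K (g b) else 0)) ->
    (forall u r v, S r ->
       pathlin (basis_row \o f) (pathU K u * r * pathU K v) = 0) ->
  has_dimension (quotalg S) #|B|.
Proof.
move=> fgK red kill.
pose F := @pathlin K Q _ (basis_row \o f).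
have FI x y : ideal_gen S (x - y) -> F x = F y.
  by move=> /(pathlin_ideal0 kill) /eqP; rewrite linearB subr_eq0 => /eqP.
pose N (r : 'rV[K]_#|B|) : KQ :=
  \sum_(j < #|B|) r 0 j *: pathU K (g (enum_val j)).
have NL : linear N.
  move=> c r s; rewrite /N scaler_sumr -big_split; apply: eq_bigr => j _.
  by rewrite !mxE scalerDl scalerA.
have FN r : F (N r) = r.
  rewrite /N /F linear_sum [RHS]row_sum_delta; apply: eq_bigr => j _.
  by rewrite linearZ /= pathlinU /= fgK /= enum_valK.
have NF x : ideal_gen S (N (F x) - x).
  elim/pathalg_lin_ind: x => [|c p x IH].
    rewrite subr0 [F 0]raddf0 /N big1 => [|j _]; last by rewrite mxE scale0r.
    exact: ideal_gen0.
  have -> : F (c *: pathU K p + x) = c *: (basis_row \o f) p + F x.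
    by rewrite /F linearP /= pathlinU.
  rewrite NL opprD addrACA -scalerBr.
  apply: ideal_gen_add => //; apply: ideal_gen_scale.
  rewrite -opprB; apply: ideal_gen_opp.
  suff -> : N ((basis_row \o f) p) = if f p is Some b then pathU K (g b) else 0.
    exact: red.
  rewrite /N /= /basis_row; case: (f p) => [b|]; last first.
    by rewrite big1 // => j _; rewrite mxE scale0r.
  rewrite (bigD1 (enum_rank b)) //= mxE !eqxx scale1r enum_rankK big1 ?addr0 //.
  by move=> j /negPf ne; rewrite mxE ne andbF scale0r.
constructor; exists (fun x => F (repr x)).
  move=> c x y; rewrite /F -linearP; apply: FI; apply/quotalg_eqP.
  rewrite reprK quotalg_piD -[\pi_(quotalg S) (c *: repr x)]quotalg_piZ.
  by rewrite !reprK.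
exists (fun r => \pi_(quotalg S) (N r)) => [x|r].
  by rewrite -[RHS]reprK; apply/quotalg_eqP; apply: NF.
by rewrite -[RHS]FN; apply: FI; apply: quotalg_repr.
Qed.

End MonomialDimension.

Arguments basis_row K {B} o.

(** * Factoring and multiplying paths *)

Section PathProducts.
Variables (K : fieldType) (Q : quiver).
Implicit Types (p q : qpath Q).

Lemma qpath_split p s1 s2 : parrows p = s1 ++ s2 ->
  exists p1 p2, [/\ parrows p1 = s1, parrows p2 = s2
    & pathU K p = pathU K p1 * pathU K p2].
Proof.
move=> e; have := valP p; rewrite -/(parrows p) e walk_cat => /andP[w1 w2].
exists (@QPath Q (psource p, s1) w1).
exists (@QPath Q (last (psource p) (map (@qtgt Q) s1), s2) w2); split=> //.
rewrite pathU_mul /pmul eqxx; congr (pathU K _); apply: val_inj.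
rewrite val_pcat // -[RHS]/(psource p, s1 ++ s2) -e.
exact: surjective_pairing.
Qed.

Variant pathU_mul_spec p q : pathalg K Q -> Prop :=
  | PathUMulCat r of ptarget p = psource q & psource r = psource p
      & ptarget r = ptarget q & parrows r = parrows p ++ parrows q :
      pathU_mul_spec p q (pathU K r)
  | PathUMul0 of ptarget p != psource q : pathU_mul_spec p q 0.

Lemma pathU_mulP p q : pathU_mul_spec p q (pathU K p * pathU K q).
Proof.
rewrite pathU_mul /pmul; case: eqVneq => e; last exact: PathUMul0.
by apply: PathUMulCat; rewrite ?psource_cat ?ptarget_cat ?parrows_cat.
Qed.

End PathProducts.

(** * Orbits of arrows under the successor map *)

Section BrauerDimension.
Variables (K : fieldType) (G : brauer_configuration).
Local Notation Q := (bquiver G).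
Local Notation poly := (@bc_polygon G).
Local Notation arrow := (barrow G).
Local Notation succ := (@succ_arrow G).
Local Notation src := (@qsrc Q).
Implicit Types (b c : arrow) (p q : qpath Q).

Definition cycle_length b : nat := valency poly (val (tag b)).
Definition cycle_mult b : nat := bc_mult (val (tag b)).
Definition arrow_weight b : nat := (cycle_mult b * cycle_length b)%N.

Lemma card_occurrence (a : bc_vertex G) :
  #|{: occurrence poly a}| = valency poly a.
Proof.
rewrite card_tagged sumnE big_map big_enum.
by apply: eq_bigr => V _; rewrite card_ord.
Qed.

Lemma porbit_orient (a : bc_vertex G) (x : occurrence poly a) :
  #|porbit (bc_orient a) x| = valency poly a.
Proof.
by rewrite -card_occurrence; apply: eq_card => y; rewrite bc_orient_cyclic.
Qed.

Lemma sum_arrow_weight :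
  (\sum_(b : arrow) (arrow_weight b - 1) =
   \sum_(a : ntvertex G)
     valency poly (val a) * (bc_mult (val a) * valency poly (val a) - 1))%N.
Proof.
transitivity (\sum_(a : ntvertex G) \sum_(x : occurrence poly (val a))
    (bc_mult (val a) * valency poly (val a) - 1))%N.
  by rewrite sig_big_dep.
by apply: eq_bigr => a _; rewrite sum_nat_const card_occurrence.
Qed.

Lemma iter_succ n (a : ntvertex G) (x : occurrence poly (val a)) :
  iter n succ (existT _ a x) = existT _ a (iter n (bc_orient (val a)) x).
Proof. by elim: n => // n IH; rewrite !iterS IH. Qed.

Lemma tag_iter_succ n b : tag (iter n succ b) = tag b.
Proof. by case: b => a x; rewrite iter_succ. Qed.

Lemma iter_cycle_length b : iter (cycle_length b) succ b = b.
Proof.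
case: b => a x; rewrite iter_succ /cycle_length /= -(porbit_orient x).
by rewrite iter_porbit.
Qed.

Lemma iter_cycle_lengthM m b : iter (m * cycle_length b) succ b = b.
Proof.
by elim: m => // m IH; rewrite mulSn iterD IH iter_cycle_length.
Qed.

Lemma same_tag_succ b c :
  tag b = tag c -> exists2 n, (n < cycle_length b)%N & c = iter n succ b.
Proof.
case: b c => [a x] [a' y] /= e; case: _ / e y => y.
have := bc_orient_cyclic x y; rewrite porbit_traject => /trajectP[n lt ->].
by exists n; rewrite ?iter_succ // /cycle_length /= -(porbit_orient x).
Qed.

Lemma cycle_length_gt0 b : (0 < cycle_length b)%N.
Proof.
case: b => a x; rewrite /cycle_length /= -card_occurrence.
by apply/card_gt0P; exists x.
Qed.

(** An arrow belongs to a nontruncated vertex, which excludes weight 1. *)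
Lemma arrow_weight_gt1 b : (1 < arrow_weight b)%N.
Proof.
rewrite ltn_neqAle eq_sym muln_gt0 cycle_length_gt0 bc_mult_gt0.
by rewrite !andbT /arrow_weight mulnC; exact: (valP (tag b)).
Qed.

Lemma arrow_weight_gt0 b : (0 < arrow_weight b)%N.
Proof. exact: ltnW (arrow_weight_gt1 b). Qed.

Lemma iter_arrow_weight b : iter (arrow_weight b) succ b = b.
Proof. exact: iter_cycle_lengthM. Qed.

(** * Paths along a special cycle *)

Definition bpath b n : qpath Q :=
  @QPath Q (src b, traject succ b n) (walk_traject b n).

Lemma ptarget_bpath b n : ptarget (bpath b n) = src (iter n succ b).
Proof. by elim: n b => // n IH b; rewrite iterSr -IH. Qed.

Lemma bpathM b m n :
  pathU K (bpath b m) * pathU K (bpath (iter m succ b) n) =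
  pathU K (bpath b (m + n)).
Proof.
case: pathU_mulP => [r _ sr _ er|]; last by rewrite ptarget_bpath eqxx.
congr (pathU K _); apply: val_inj; transitivity (psource r, parrows r).
  exact: surjective_pairing.
by rewrite sr er /parrows /= trajectD.
Qed.

(** The case [n = 0] is excluded because the zeroth power is the sum of all trivial paths, whereas
    [bpath b 0] is a single one. *)
Lemma scycleX b n : (0 < n)%N ->
  pathU K (scycle b) ^+ n = pathU K (bpath b (n * cycle_length b)).
Proof.
case: n => // n _; elim: n => [|n IH].
  by rewrite expr1 mul1n; congr (pathU K _); apply: val_inj.
rewrite exprSr IH [(n.+2 * _)%N]mulSnr -bpathM iter_cycle_lengthM.
by have -> : scycle b = bpath b (cycle_length b) by apply: val_inj.
Qed.

Lemma scycle_mult b :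
  pathU K (scycle b) ^+ cycle_mult b = pathU K (bpath b (arrow_weight b)).
Proof. by rewrite scycleX ?bc_mult_gt0. Qed.

Lemma scycle_mult_arrow b :
  pathU K (scycle b) ^+ cycle_mult b * pathU K (parrow (Q := Q) b) =
  pathU K (bpath b (arrow_weight b).+1).
Proof.
rewrite scycle_mult -[(arrow_weight b).+1]addn1 -bpathM iter_arrow_weight.
by have -> : parrow (Q := Q) b = bpath b 1 by apply: val_inj.
Qed.

Lemma sorted_traject b n : sorted (frel succ) (traject succ b n).
Proof. by case: n => //= n; apply: fpath_traject. Qed.

Lemma parrows_cons p b s : parrows p = b :: s -> psource p = src b.
Proof.
by move=> e; have := valP p; rewrite -/(parrows p) e => /andP[/eqP].
Qed.

(** Sortedness for [frel succ] expresses that a path stays on one special cycle; the first arrow and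
    the length then determine it. *)
Lemma sorted_bpath p b s : parrows p = b :: s -> sorted (frel succ) (b :: s) ->
  p = bpath b (size s).+1.
Proof.
move=> e /= /fpathE es; apply: val_inj; transitivity (psource p, parrows p).
  exact: surjective_pairing.
by rewrite (parrows_cons e) e /= -es.
Qed.

(** Locates the factor of length two at which a path leaves its special cycle; it will be a type
    three relation. *)
Lemma unsorted_split (T : eqType) (f : T -> T) (s : seq T) :
  ~~ sorted (frel f) s ->
  exists s1 x y s2, s = s1 ++ [:: x; y] ++ s2 /\ y != f x.
Proof.
case: s => // x s; elim: s x => //= y s IH x.
rewrite negb_and; case: eqVneq => [_ /IH|ne _].
  by move=> [s1 [z [t [s2 [-> ne]]]]]; exists (x :: s1), z, t, s2.
by exists [::], x, y, s; rewrite eq_sym.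
Qed.

Lemma ex_arrow (V : bc_label G) : exists b : arrow, src b == V.
Proof.
have [a aV lt] := bc_nontruncP V.
have nt : ~~ truncated a by rewrite /truncated (gtn_eqF lt).
have lt0 : (0 < occ poly a V)%N by rewrite /occ multiset.in_mset in aV.
by exists (existT _ (exist _ a nt) (existT _ V (Ordinal lt0))).
Qed.

(** The choice is harmless: type one relations identify the maximal paths of all arrows starting at
    [V]. *)
Definition arrow_at V : arrow := xchoose (ex_arrow V).

Lemma src_arrow_at V : src (arrow_at V) = V.
Proof. exact/eqP/(xchooseP (ex_arrow V)). Qed.

Local Notation rel := (@brauer_rel G K).

Lemma special_at_scycle b : special_at (tag b) (src b) (scycle b).
Proof. by case: b => a x; exists x. Qed.

Lemma special_scycle b : special (tag b) (scycle b).
Proof. by exists (src b); apply: special_at_scycle. Qed.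

Lemma special_cycle_sorted (C : qpath Q) :
  special_cycle C -> sorted (frel succ) (parrows C).
Proof. by move=> [a [V [x [_ ->]]]]; apply: sorted_traject. Qed.

Lemma special_atE a V (C : qpath Q) : special_at a V C ->
  exists b, [/\ tag b = a, src b = V & C = scycle b].
Proof. by move=> [x [<- ->]]; exists (existT _ a x). Qed.

Lemma rel_three_succ p b c :
  parrows p = [:: b; c] -> c != succ b -> rel (pathU K p).
Proof.
move=> e ne; apply: (rel_three K e) => [C /special_cycle_sorted sC|].
  apply/negP => /infix_sorted/(_ sC) /=; rewrite andbT => /eqP eC.
  by rewrite eC eqxx in ne.
(* At valency 1 the successor map fixes [b], so the exempt square of a loop does have
   [c = succ b]. *)
apply/negP => /and3P[/eqP ebc /eqP v1 _]; case/negP: ne.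
rewrite -ebc; move: (iter_cycle_length b); rewrite /cycle_length v1 /= => eb.
by rewrite eb.
Qed.

(** Converse of [rel_three_succ]. If [c = succ b], then either the valency is 1 and nontruncation
    gives multiplicity above 1, which is the exempt loop, or the cycle has at least two arrows and
    begins with [b], [c]. *)
Lemma pair_not_succ b c :
  (forall C, special_cycle C -> ~~ infix [:: b; c] (parrows C)) ->
  ~~ [&& b == c, valency poly (val (tag b)) == 1%N
       & (1 < bc_mult (val (tag b)))%N] ->
  c != succ b.
Proof.
move=> ninf nloop; apply: contra nloop => /eqP ec; rewrite {c}ec in ninf *.
have := cycle_length_gt0 b; rewrite /cycle_length leq_eqVlt.
case: eqVneq => [v1 _|_ /= v2].
  have eb := iter_cycle_length b; rewrite /cycle_length -v1 /= in eb.
  have := arrow_weight_gt1 b; rewrite /arrow_weight /cycle_length -v1 muln1.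
  by rewrite eb eqxx.
have := ninf _ (ex_intro _ (tag b) (special_scycle b)).
rewrite /parrows /= /scycle_arrows -(subnKC v2) trajectD.
by rewrite /= !eqxx prefix0s.
Qed.

(** * The monomial basis *)

(** Indexes trivial paths, maximal paths by their source, and shorter nontrivial paths by first
    arrow. In the last summand [k] stands for length [k + 1]. *)
Definition bbasis : Type :=
  (bc_label G + bc_label G + {b : arrow & 'I_(arrow_weight b - 1)})%type.

HB.instance Definition _ := Finite.on bbasis.

Definition basis_path (i : bbasis) : qpath Q :=
  match i with
  | inl (inl V) => ptriv (Q := Q) V
  | inl (inr V) => bpath (arrow_at V) (arrow_weight (arrow_at V))
  | inr (existT b k) => bpath b k.+1
  end.

(* The normal form of the class of [p] in the algebra; [None] means that the
   class is 0. *)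
Definition basis_of (p : qpath Q) : option bbasis :=
  if parrows p is b :: s then
    if sorted (frel succ) (b :: s) then
      if (size s).+1 == arrow_weight b then Some (inl (inr (src b)))
      else omap (fun k : 'I_(arrow_weight b - 1) => inr (existT _ b k))
           (insub (size s))
    else None
  else Some (inl (inl (psource p))).

Lemma basis_of_max p b : parrows p = traject succ b (arrow_weight b) ->
  basis_of p = Some (inl (inr (src b))).
Proof.
rewrite -(prednK (arrow_weight_gt0 b)) /basis_of => -> /=.
by rewrite fpath_traject size_traject prednK ?eqxx ?arrow_weight_gt0.
Qed.

Lemma basis_pathK i : basis_of (basis_path i) = Some i.
Proof.
case: i => [[V|V]|[b k]] //.
  by rewrite (@basis_of_max _ (arrow_at V)) // src_arrow_at.
rewrite /basis_of /parrows /= fpath_traject size_traject; have := ltn_ord k.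
by rewrite ltn_subRL add1n => /ltn_eqF ->; rewrite (valK k).
Qed.

Lemma basis_of_long p b s : parrows p = b :: s ->
  (arrow_weight b < (size s).+1)%N -> basis_of p = None.
Proof.
move=> e lt; rewrite /basis_of e; case: ifP => // _.
rewrite gtn_eqF // insubF // ltn_subRL add1n.
by apply/negbTE; rewrite -leqNgt ltnW.
Qed.

Lemma basis_of_unsorted p : ~~ sorted (frel succ) (parrows p) ->
  basis_of p = None.
Proof. by rewrite /basis_of; case: (parrows p) => // b s /negPf->. Qed.

Lemma arrow_weight_sorted b s c : sorted (frel succ) (b :: s) ->
  c \in b :: s -> arrow_weight c = arrow_weight b.
Proof.
move=> /= /fpathE -> /(trajectP (n := _.+1))[n _ ->].
by rewrite /arrow_weight /cycle_mult /cycle_length tag_iter_succ.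
Qed.

(* A path properly containing the maximal cycle power [bpath c (arrow_weight c)]
   is either too long or leaves the special cycle. *)
Lemma basis_of_contains p s1 s2 c :
  parrows p = s1 ++ traject succ c (arrow_weight c) ++ s2 ->
  (0 < size s1 + size s2)%N -> basis_of p = None.
Proof.
move=> e lt; have [so|] := boolP (sorted (frel succ) (parrows p)); last first.
  exact: basis_of_unsorted.
case eb : (parrows p) (e) so => [|b s] e' so.
  have := arrow_weight_gt0 c; move/(congr1 size): e'.
  rewrite !size_cat size_traject => /esym/eqP.
  by rewrite !addn_eq0 => /and3P[_ /eqP-> _].
apply: (basis_of_long eb); rewrite -/(size (b :: s)) e' !size_cat size_traject.
rewrite addnCA -[X in (X < _)%N]addn0 -(@arrow_weight_sorted b s c) //.
  by rewrite ltn_add2l.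
rewrite e' !mem_cat; have := arrow_weight_gt0 c.
by case: (arrow_weight c) => //= n _; rewrite in_cons eqxx orbT.
Qed.

Lemma basis_row_kill u r v : rel r ->
  pathlin (basis_row K \o basis_of) (pathU K u * r * pathU K v) = 0.
Proof.
case=> [V a a' C D sC sD|a C b sC hC|p b c e ninf nloop].
- have [b [<- sb ->]] := special_atE sC; have [c [<- sc ->]] := special_atE sD.
  rewrite !scycle_mult mulrBr mulrBl linearB /=; apply/eqP; rewrite subr_eq0.
  apply/eqP; have tb x : ptarget (bpath x (arrow_weight x)) = src x.
    by rewrite ptarget_bpath iter_arrow_weight.
  (* The value depends on [x] only through its source [V], so the two sides of a type one relation
     cancel. *)
  have value (x : arrow) : src x = V ->
    pathlin (basis_row K \o basis_of)
      (pathU K u * pathU K (bpath x (arrow_weight x)) * pathU K v) =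
    if [&& ptarget u == V, V == psource v, parrows u == [::]
         & parrows v == [::]] then basis_row K (Some (inl (inr V))) else 0.
    move=> sx; case: pathU_mulP => [q uq sq tq eq|]; last first.
      by rewrite [psource _]sx mul0r raddf0 => /negPf->.
    rewrite uq [psource _]sx eqxx.
    case: pathU_mulP => [w qv sw tw ew|]; last first.
      by rewrite tq tb sx raddf0 => /negPf->.
    rewrite -qv tq tb sx eqxx /= pathlinU /=; rewrite eq -catA in ew.
    case: ifP => [/andP[/eqP u0 /eqP v0]|].
      rewrite u0 v0 cats0 in ew.
      by rewrite (basis_of_max ew) sx.
    rewrite -!size_eq0 -addn_eq0 => /negbT; rewrite -lt0n => lt.
    by rewrite (basis_of_contains ew lt).
  by rewrite !value.
- have [V /special_atE[c [<- sc eC]]] := sC; move: hC.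
  rewrite eC => hC; have -> : b = c.
    move: hC; rewrite /parrows /= /scycle_arrows.
    have := cycle_length_gt0 c; rewrite /cycle_length.
    by case: valency => //= n _ [].
  rewrite scycle_mult_arrow.
  case: pathU_mulP => [q _ _ _ eq|_]; last by rewrite mul0r raddf0.
  case: pathU_mulP => [w _ _ _ ew|_]; last by rewrite raddf0.
  (* Splitting off the last arrow leaves a nonempty remainder after the maximal path, even when [u]
     and [v] are trivial. *)
  rewrite eq -[(arrow_weight c).+1]addn1 [parrows (bpath _ _)]trajectD in ew.
  rewrite -!catA in ew.
  by rewrite pathlinU /= (basis_of_contains ew) // size_cat addnC.
have ne := pair_not_succ ninf nloop.
case: pathU_mulP => [q _ _ _ eq|_]; last by rewrite mul0r raddf0.
case: pathU_mulP => [w _ _ _ ew|_]; last by rewrite raddf0.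
rewrite pathlinU /= basis_of_unsorted // ew eq e -catA; apply/negP => so.
have /= := infix_sorted _ so; move=> /(_ [:: b; c]) /=.
rewrite infix_infix andbT => /(_ isT) /eqP es.
by rewrite es eqxx in ne.
Qed.

(** A path leaving its special cycle has a type three factor, one of maximal length is moved to the
    chosen arrow by a type one relation, and a longer one has a type two prefix. *)
Lemma basis_path_reduce p : ideal_gen rel
  (pathU K p - if basis_of p is Some i then pathU K (basis_path i) else 0).
Proof.
have gen r : rel r -> ideal_gen rel r.
  by move=> rr; rewrite -[r]mul1r -[1 * r]mulr1 -[X in ideal_gen _ X]addr0;
    apply: ideal_genD => //; apply: ideal_gen0.
case e : (parrows p) => [|b s].
  rewrite /basis_of e /=; have -> : ptriv (Q := Q) (psource p) = p.
    by apply: val_inj; rewrite /= -e; apply/esym/surjective_pairing.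
  by rewrite subrr; apply: ideal_gen0.
have [so|ns] := boolP (sorted (frel succ) (b :: s)); last first.
  rewrite basis_of_unsorted ?e // subr0.
  have [s1 [x [y [s2 [es ne]]]]] := unsorted_split ns.
  rewrite es in e; have [p1 [p' [_ e' ->]]] := qpath_split K e.
  have [p2 [p3 [e2 _ ->]]] := qpath_split K e'.
  apply/ideal_gen_mull/ideal_gen_mulr/gen; exact: rel_three_succ e2 ne.
rewrite (sorted_bpath e so); move: (size s) => {e so}n.
rewrite /basis_of /parrows /= fpath_traject size_traject.
case: eqVneq => [en|ne] /=.
  rewrite en -!scycle_mult; apply/gen/rel_one; last exact: special_at_scycle.
  by rewrite src_arrow_at; apply: special_at_scycle.
case: insubP => [k _ <-|] /=; first by rewrite subrr; apply: ideal_gen0.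
rewrite ltn_subRL add1n -leqNgt subr0 leq_eqVlt eq_sym (negPf ne) /= => lt.
(* Cut after [arrow_weight b + 1] arrows, the length of a type two relation. *)
rewrite -(subnKC lt) -bpathM; apply: ideal_gen_mulr.
rewrite -scycle_mult_arrow; apply/gen/rel_two; first exact: special_scycle.
rewrite /parrows /= /scycle_arrows; have := cycle_length_gt0 b.
by rewrite /cycle_length; case: valency.
Qed.

Lemma card_bbasis :
  #|{: bbasis}| = (2 * #|bc_label G| + \sum_(b : arrow) (arrow_weight b - 1))%N.
Proof.
rewrite [LHS]card_sum card_sum mul2n addnn card_tagged sumnE big_map big_enum.
by congr addn; apply: eq_bigr => b _; rewrite card_ord.
Qed.

Lemma brauer_dimension : has_dimension (brauer_algebra G K)
  (2 * #|bc_label G| + \sum_(b : arrow) (arrow_weight b - 1)).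
Proof.
rewrite -card_bbasis; apply: (quotalg_dimension basis_pathK).
  exact: basis_path_reduce.
exact: basis_row_kill.
Qed.

(** * Equivalence classes of special cycles *)

(** The arrows of one vertex form a single orbit, so [c] lies [n] steps after [b], and rotating by
    [n] moves one cycle to the other. *)
Lemma cyc_equiv_same_tag b c :
  tag b = tag c -> cyc_equiv (scycle b) (scycle c).
Proof.
move=> e; have [n lt ec] := same_tag_succ e; exists n.
rewrite /parrows /= /scycle_arrows -e -/(cycle_length b) ec.
have le := ltnW lt; rewrite -{2}(subnKC le) trajectD.
rewrite -{2}(size_traject succ b n) rot_size_cat -{1}(subnK le) trajectD.
by rewrite -iterD (subnK le) iter_cycle_length.
Qed.

Lemma plength_special a (C : qpath Q) :
  special a C -> plength C = valency poly (val a).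
Proof.
by move=> [V /special_atE[b [<- _ ->]]]; rewrite /plength size_traject.
Qed.

Lemma special_tag a (C : qpath Q) : special a C ->
  exists2 b, C = scycle b & tag b = a.
Proof. by move=> [V /special_atE[b [<- _ ->]]]; exists b. Qed.

(** Rotation preserves the set of arrows, and all arrows of a special cycle carry the same
    vertex. *)
Lemma cyc_equiv_tag a a' (C D : qpath Q) :
  special a C -> special a' D -> cyc_equiv C D -> a' = a.
Proof.
move=> /special_tag[b -> <-] /special_tag[c -> <-] [k ek].
have : c \in rot k (parrows (scycle b)).
  rewrite -ek /parrows /= /scycle_arrows; have := cycle_length_gt0 c.
  by rewrite /cycle_length; case: valency => // n _; rewrite inE eqxx.
by rewrite mem_rot => /trajectP[n _ ->]; rewrite tag_iter_succ.
Qed.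

Lemma ntvertex_arrow (a : ntvertex G) : exists b : arrow, tag b = a.
Proof.
have [V aV] := bc_vertexP (val a).
have lt0 : (0 < occ poly (val a) V)%N by rewrite /occ multiset.in_mset in aV.
by exists (existT _ a (existT _ V (Ordinal lt0))).
Qed.

(** Surjective since every nontruncated vertex has a special cycle, whose representative belongs to
    the same vertex; injective since cycles at one vertex are equivalent and so share one
    representative. *)
Lemma representatives_bij t (C : 'I_t -> qpath Q) (alpha : 'I_t -> ntvertex G) :
  representatives C -> (forall i, special (alpha i) (C i)) -> bijective alpha.
Proof.
move=> [_ rC] sC.
have surj a : exists i, alpha i == a.
  have [b <-] := ntvertex_arrow a.
  have [i [/cyc_equiv_tag ei _]] :=
    rC _ (ex_intro _ (tag b) (special_scycle b)).
  by exists i; apply/eqP; apply: ei (sC i); apply: special_scycle.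
have inj : injective alpha.
  move=> i j eij; have [b Ci tb] := special_tag (sC i).
  have [c Cj tc] := special_tag (sC j).
  have [k [_ uk]] := rC (C i) (ex_intro _ (alpha i) (sC i)).
  (* Both [i] and [j] equal the unique index [k] representing [C i]; for [i] the rotation is by
     0. *)
  rewrite -(uk i); last by exists 0%N; rewrite rot0.
  by apply: uk; rewrite Ci Cj; apply: cyc_equiv_same_tag; rewrite tb tc.
exists (fun a => xchoose (surj a)) => [i|a]; last exact/eqP/(xchooseP (surj a)).
by apply: inj; apply/eqP/(xchooseP (surj (alpha i))).
Qed.

End BrauerDimension.

Theorem proposition3p13 (K : fieldType) (Gamma : brauer_configuration)
    (t : nat) (C : 'I_t -> qpath (bquiver Gamma))
    (alpha : 'I_t -> ntvertex Gamma) :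
  representatives C ->
  (forall i : 'I_t, special (alpha i) (C i)) ->
  has_dimension (brauer_algebra Gamma K)
    (2 * #|qvertex (bquiver Gamma)| +
     \sum_(i < t)
       plength (C i) * (bc_mult (val (alpha i)) * plength (C i) - 1)).
Proof.
move=> rC sC; have := brauer_dimension K Gamma.
rewrite sum_arrow_weight (reindex alpha) /=; last first.
  exact/onW_bij/(representatives_bij rC sC).
congr (has_dimension _ (_ + _)%N); apply: eq_bigr => i _.
by rewrite (plength_special (sC i)).
Qed.
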